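(* Let $R$ be a commutative ring with unity, $M$ a free $R$-module of finite rank $m$, $1\le k\le m$, and $\omega_1,\dots,\omega_k\in M$. Put $\Omega=\omega_1\wedge\cdots\wedge\omega_k$. Fix integers $1\le p,r,s\le m$ such that $p\ge r$ and $r+s=k+1$. For $\eta\in\Lambda^pM$ consider the condition (B) $\ \omega_I\wedge\eta=0$ for all $I\in\mathcal J(s,k)$. (i) Assume that $p-r\le \operatorname{depth} I(\Omega)-2$. Then an element $\eta\in\Lambda^pM$ can be represented in the form $$\eta=\sum_{J\in\mathcal J(r,k)}\omega_J\wedge\gamma_J\quad\text{for some }\gamma_J\in\Lambda^{p-r}M$$ if and only if $\eta$ satisfies (B). (ii) Without assuming the inequality $p-r\le \operatorname{depth} I(\Omega)-2$, for any $\eta\in\Lambda^pM$ satisfying (B) there exists an integer $n>0$ such that for every $a\in I(\Omega)$, with $b=a^n$, one has (A') $\ b\eta=\sum_{J\in\mathcal J(r,k)}\omega_J\wedge\gamma_J\ $ for some $\gamma_J\in\Lambda^{p-r}M$. If the $R$-module of all $\eta\in\Lambda^pM$ satisfying (B) is finitely generated, then $n$ can be chosen independent of $\eta$. Conversely, if $\eta\in\Lambda^pM$ and (A') holds for some non-zero-divisor $b\in R$, then (B) holds.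
   Context: $\Lambda^qM$ is the $q$th exterior power of $M$ over $R$, with $\Lambda^0M=R$, $\Lambda^1M=M$, and $\Lambda^qM=0$ for $q<0$ or $q>m$. $\mathcal J(r,k)$ denotes the set of strictly increasing multiindices $J=(j_1,\dots,j_r)$ with $1\le j_1<\cdots<j_r\le k$ (for $r=0$ it consists of the empty multiindex). For $J\in\mathcal J(r,k)$, $\omega_J=\omega_{j_1}\wedge\cdots\wedge\omega_{j_r}$, with $\omega_\emptyset=1$. $I(\Omega)\subset R$ is the ideal generated by the coefficients of $\Omega$ in the basis $e_{i_1}\wedge\cdots\wedge e_{i_k}$, $i_1<\dots<i_k$, of $\Lambda^kM$ induced by a basis $e_1,\dots,e_m$ of $M$; it does not depend on the basis. A sequence $a_1,\dots,a_q$ in $R$ is regular if $(a_1,\dots,a_q)\ne R$ and $a_i$ is a non-zero-divisor on $R/(a_1,\dots,a_{i-1})$ for $i=1,\dots,q$. The depth of a proper ideal $I$, $\operatorname{depth} I$, is the supremum of the lengths of regular sequences contained in $I$; by convention $\operatorname{depth} R=\infty$. $R$ is not assumed Noetherian. *)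

(* Defs.v *)
From HB Require Import structures.
From mathcomp Require Import all_boot all_order all_algebra.
From mathcomp Require Import boolp classical_sets constructive_ereal.

Set Implicit Arguments.
Unset Strict Implicit.
Unset Printing Implicit Defensive.

Import Order.TTheory GRing.Theory Num.Theory.

Local Open Scope classical_set_scope.
Local Open Scope ring_scope.

Definition is_basis (R : comPzRingType) (M : lmodType R) (m : nat)
    (e : 'I_m -> M) : Prop :=
  forall x : M, exists! c : {ffun 'I_m -> R}, x = \sum_i c i *: e i.

(* The exterior algebra of M, by its universal property among R-algebras.
   An R-algebra is a ring A with a ring morphism R -> A whose image is central:
   the library structure algType excludes the zero ring, and R = 0 is allowed
   here.  A map that is linear for the scaling v \; *%R sends a *: x to
   v a * f x. *)
Record exteriorAlgebra (R : comPzRingType) (M : lmodType R) := ExteriorAlgebra {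
  ext_ring :> pzRingType;
  ext_scal : {rmorphism R -> ext_ring};
  ext_inj : {linear M -> ext_ring | ext_scal \; *%R};
  ext_scalC : forall (a : R) (x : ext_ring), ext_scal a * x = x * ext_scal a;
  ext_sqr0 : forall x : M, ext_inj x * ext_inj x = 0;
  ext_univ : forall (A : pzRingType) (v : {rmorphism R -> A})
      (f : {linear M -> A | v \; *%R}),
    (forall (a : R) (y : A), v a * y = y * v a) ->
    (forall x : M, f x * f x = 0) ->
    exists g : {rmorphism ext_ring -> A},
      [/\ forall a : R, g (ext_scal a) = v a,
          forall x : M, g (ext_inj x) = f x
        & forall h : {rmorphism ext_ring -> A},
            (forall a : R, h (ext_scal a) = v a) ->
            (forall x : M, h (ext_inj x) = f x) -> h =1 g] }.

(* The q-th exterior power of M, as the degree q part of the exterior algebra;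
   the coefficients c are needed only for q = 0. *)
Definition ext_power (R : comPzRingType) (M : lmodType R)
    (L : exteriorAlgebra M) (q : nat) : set L :=
  [set x | exists (n : nat) (c : 'I_n -> R) (v : 'I_n -> 'I_q -> M),
     x = \sum_(i < n) ext_scal L (c i) * \prod_(j < q) ext_inj L (v i j)].

Definition multiindices (r k : nat) : {pred r.-tuple 'I_k} :=
  [pred J : r.-tuple 'I_k | sorted ltn [seq val j | j <- J]].
Arguments multiindices : clear implicits.

Definition wedge (R : comPzRingType) (M : lmodType R) (L : exteriorAlgebra M)
    (k : nat) (omega : 'I_k -> M) (r : nat) (J : r.-tuple 'I_k) : L :=
  \prod_(j <- J) ext_inj L (omega j).

Definition gen_ideal (R : comPzRingType) (S : set R) : set R :=
  [set x | exists (n : nat) (c a : 'I_n -> R),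
     (forall i, S (a i)) /\ x = \sum_(i < n) c i * a i].

(* The products of basis vectors e_I are a basis of the k-th exterior power, so
   the family c of coefficients of Omega is unique. *)
Definition coef_ideal (R : comPzRingType) (M : lmodType R)
    (L : exteriorAlgebra M) (m : nat) (e : 'I_m -> M) (k : nat) (Omega : L) :
    set R :=
  [set a | exists c : k.-tuple 'I_m -> R,
     Omega = \sum_(I in multiindices k m) ext_scal L (c I) * wedge L e I /\
     gen_ideal [set c I | I in [set` multiindices k m]] a].

Definition regular_seq (R : comPzRingType) (a : seq R) : Prop :=
  gen_ideal [set` a] <> setT /\
  forall i : nat, (i < size a)%N -> forall x : R,
    gen_ideal [set` take i a] (a`_i * x) -> gen_ideal [set` take i a] x.

Definition depth (R : comPzRingType) (I : set R) : \bar int :=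
  if `[< I = setT >] then +oo%E
  else supremum 0%E [set ((size a)%:Z)%:E | a in
         [set a : seq R | regular_seq a /\ [set` a] `<=` I]].

Definition condB (R : comPzRingType) (M : lmodType R) (L : exteriorAlgebra M)
    (k : nat) (omega : 'I_k -> M) (s : nat) (eta : L) : Prop :=
  forall I : s.-tuple 'I_k, I \in multiindices s k -> wedge L omega I * eta = 0.

Definition representable (R : comPzRingType) (M : lmodType R)
    (L : exteriorAlgebra M) (k : nat) (omega : 'I_k -> M) (p r : nat)
    (eta : L) : Prop :=
  exists gamma : r.-tuple 'I_k -> L,
    (forall J, ext_power (p - r) (gamma J)) /\
    eta = \sum_(J in multiindices r k) wedge L omega J * gamma J.

Definition fin_gen (R : comPzRingType) (M : lmodType R)
    (L : exteriorAlgebra M) (N : set L) : Prop :=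
  exists (n : nat) (g : 'I_n -> L), (forall i, N (g i)) /\
    forall x, N x -> exists c : 'I_n -> R,
      x = \sum_(i < n) ext_scal L (c i) * g i.

(* Main.v *)
(* If linear functionals phi_1, ..., phi_k satisfy phi_i(omega_j) = a delta_ij,
   contraction h_i by phi_i satisfies h_i omega_i + omega_i h_i = a, where omega_i
   stands for left multiplication.  Expanding a^k = prod_i (h_i omega_i + omega_i h_i)
   applied to eta, each term contains either s of the factors omega_i next to eta,
   and vanishes by (B), or r of them on the left, so a^k eta is representable.
   Each coefficient a of Omega has such functionals (Cramer's rule), hence a power
   of a in I(Omega), with an exponent depending only on m and k, makes eta
   representable.

   For (i), let a_1, a_2, ... be a regular sequence in I(Omega).  As a_1^n eta is
   representable, it suffices to cancel factors a_1.  If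
   a_1 eta = sum_J omega_J g_J, then Omega g_J = 0 modulo a_1 by multiplication
   with the complementary omega's; induction on the degree modulo a_1 shows that
   g_J is a combination of the omega_i modulo a_1, and subtracting the multiples
   of a_1 from eta replaces r by r + 1, until r exceeds p. *)
From HB Require Import structures.
Require Import Defs.
From mathcomp Require Import all_boot all_order all_algebra.
From mathcomp Require Import boolp classical_sets constructive_ereal.
From mathcomp Require Import zify.

Set Implicit Arguments.
Unset Strict Implicit.
Unset Printing Implicit Defensive.

Import Order.TTheory GRing.Theory Num.Theory.

Local Open Scope classical_set_scope.
Local Open Scope ring_scope.

(* [big_enum] is stated for commutative laws only. *)
Lemma prod_enum (A : pzRingType) (I : finType) (F : I -> A) :
  \prod_(i <- enum I) F i = \prod_i F i.
Proof. by rewrite enumT [index_enum _]unlock. Qed.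

(* (a, b, d) stands for the matrix [[a, b], [0, d]]. *)
Definition triangular (A : pzRingType) : Type := (A * A * A)%type.

(** * Upper triangular 2 x 2 matrices over a ring *)

Section Triangular.
Variable A : pzRingType.
HB.instance Definition _ := GRing.Zmodule.on (triangular A).

Definition tri (a b d : A) : triangular A := (a, b, d).
Definition tri_mul (x y : triangular A) :=
  tri (x.1.1 * y.1.1) (x.1.1 * y.1.2 + x.1.2 * y.2) (x.2 * y.2).

Fact tri_mulA : associative tri_mul.
Proof.
move=> [[a b] d] [[a' b'] d'] [[a'' b''] d''].
by rewrite /tri_mul /= !mulrDr !mulrDl !mulrA addrA.
Qed.
Fact tri_mul1 : left_id (tri 1 0 1) tri_mul.
Proof. by move=> [[a b] d]; rewrite /tri_mul /= !mul1r mul0r addr0. Qed.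
Fact tri_mulr1 : right_id (tri 1 0 1) tri_mul.
Proof. by move=> [[a b] d]; rewrite /tri_mul /= !mulr1 mulr0 add0r. Qed.
Fact tri_mulDl : left_distributive tri_mul +%R.
Proof.
move=> [[a b] d] [[a' b'] d'] [[a'' b''] d''].
by rewrite /tri_mul /= !mulrDl addrACA.
Qed.
Fact tri_mulDr : right_distributive tri_mul +%R.
Proof.
move=> [[a b] d] [[a' b'] d'] [[a'' b''] d''].
by rewrite /tri_mul /= !mulrDr addrACA.
Qed.
HB.instance Definition _ := GRing.Zmodule_isPzRing.Build (triangular A)
  tri_mulA tri_mul1 tri_mulr1 tri_mulDl tri_mulDr.

Definition tri_corner (x : triangular A) : A := x.2.
Fact tri_corner_additive : {morph tri_corner : x y / x - y}.
Proof. by []. Qed.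
Fact tri_corner_multiplicative : monoid_morphism tri_corner.
Proof. by []. Qed.
HB.instance Definition _ :=
  GRing.isZmodMorphism.Build (triangular A) A tri_corner tri_corner_additive.
HB.instance Definition _ :=
  GRing.isMonoidMorphism.Build (triangular A) A tri_corner
    tri_corner_multiplicative.
End Triangular.

(** * Signs, contractions and degrees in the exterior algebra *)

Section ExteriorAlgebra.
Variables (R : comPzRingType) (M : lmodType R) (L : exteriorAlgebra M).

Local Notation sc := (ext_scal L).
Local Notation io := (ext_inj L).

Lemma ext_injZ (a : R) (x : M) : io (a *: x) = sc a * io x.
Proof. by rewrite linearZ. Qed.

Lemma ext_scalCA (a : R) (x y : L) : x * (sc a * y) = sc a * (x * y).
Proof. by rewrite mulrA -ext_scalC -mulrA. Qed.

Lemma ext_injC (x y : M) : io x * io y = - (io y * io x).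
Proof.
apply/eqP; rewrite -addr_eq0; apply/eqP.
by have := ext_sqr0 L (x + y); rewrite linearD mulrDl !mulrDr !ext_sqr0 add0r addr0.
Qed.

(** The universal property applied to the zero map on [M]. *)
Lemma augmentation :
  exists eps : {rmorphism L -> R}, forall a, eps (sc a) = a.
Proof.
have lin0 : linear_for (idfun \; *%R) (fun _ : M => 0 : R) by move=> a x y /=; rewrite mulr0 addr0.
pose zL := GRing.isLinear.Build R M R _ _ lin0.
pose f : {linear M -> R | idfun \; *%R} := HB.pack (fun=> 0 : R) zL.
have [] := @ext_univ _ _ L R idfun f.
- by move=> a y; rewrite mulrC.
- by move=> x; rewrite mulr0.
by move=> eps [epsE _ _]; exists eps.
Qed.

(* The contraction is the off-diagonal entry of the morphism from the exterior
   algebra to 2 x 2 matrices extending x |-> [[- x, phi x], [0, x]]. *)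
Lemma contraction (phi : M -> R) : linear_for *%R phi ->
  exists h : L -> L,
    [/\ {morph h : u v / u + v},
        forall a u, h (sc a * u) = sc a * h u,
        h 1 = 0
      & forall x u, h (io x * u) = sc (phi x) * u - io x * h u].
Proof.
move=> phiL.
pose v0 a : triangular L := tri (sc a) 0 (sc a).
have v0D : {morph v0 : a b / a - b}.
  by move=> a b; rewrite /v0 rmorphB -[tri _ _ _ - _]/(tri _ (0 - 0) _) subr0.
have v0M : monoid_morphism v0.
  split=> [|a b]; first by rewrite /v0 rmorph1.
  rewrite /v0 rmorphM -[RHS]/(tri _ (sc a * 0 + 0 * sc b) _).
  by rewrite mulr0 mul0r addr0.
pose zv := GRing.isZmodMorphism.Build R (triangular L) v0 v0D.
pose zv' := GRing.isMonoidMorphism.Build R (triangular L) v0 v0M.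
pose v : {rmorphism R -> triangular L} := HB.pack v0 zv zv'.
pose F (x : M) := tri (- io x) (sc (phi x)) (io x).
have linF : linear_for (v \; *%R) F.
  move=> a x y; rewrite /F phiL rmorphD rmorphM linearP opprD /= -mulrN.
  rewrite -[RHS]/(tri (_ + _) (sc a * sc (phi x) + 0 * io x + sc (phi y)) _).
  by rewrite mul0r addr0.
pose zL := GRing.isLinear.Build R M _ _ F linF.
pose f : {linear M -> triangular L | v \; *%R} := HB.pack F zL.
have [] := @ext_univ _ _ L _ v f.
- move=> a [[y b] d].
  rewrite -[LHS]/(tri (sc a * y) (sc a * b + 0 * d) (sc a * d)).
  rewrite -[RHS]/(tri (y * sc a) (y * 0 + b * sc a) (d * sc a)).
  by rewrite !ext_scalC mul0r mulr0 addr0 add0r.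
- move=> x; rewrite -[LHS]/(tri (- io x * - io x)
    (- io x * sc (phi x) + sc (phi x) * io x) (io x * io x)).
  by rewrite mulrNN ext_sqr0 ext_scalC mulNr addNr.
move=> g [gs gi _].
(* The lower right entry of [g] is an endomorphism fixing scalars and vectors, hence the identity by
   uniqueness. *)
have g2 u : (g u).2 = u.
  have [||k [_ _ kU]] := @ext_univ _ _ L _ sc io.
  - exact: ext_scalC.
  - exact: ext_sqr0.
  rewrite -[RHS]/(idfun u) (kU idfun) //.
  by rewrite -(kU (@tri_corner L \o g : {rmorphism L -> L})) //= => ?; rewrite ?gs ?gi.
exists (fun u => (g u).1.2); split.
- by move=> u w; rewrite rmorphD.
- by move=> a u; rewrite rmorphM gs /= mul0r addr0.
- by rewrite rmorph1.
- by move=> x u; rewrite rmorphM gi /= g2 mulNr addrC.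
Qed.

Section Words.
Variables (T : eqType) (f : T -> M).
Local Notation W s := (\prod_(j <- s) io (f j)).

(** Each transposition of two vectors changes the sign. Here and below the sign is left as a
    disjunction, since it is only used in statements insensitive to it. *)
Lemma word_move x (s : seq T) (u : L) :
  W s * (io (f x) * u) = io (f x) * (W s * u) \/
  W s * (io (f x) * u) = - (io (f x) * (W s * u)).
Proof.
elim: s => [|y s IHs]; first by rewrite big_nil !mul1r; left.
rewrite big_cons -!mulrA; have yx z : io (f y) * (io (f x) * z) =
    - (io (f x) * (io (f y) * z)) by rewrite !mulrA ext_injC mulNr.
by case: IHs => ->; rewrite ?mulrN yx ?opprK; [right|left].
Qed.

Lemma word_repeat (s : seq T) : ~~ uniq s -> W s = 0.
Proof.
elim: s => // x s IHs; rewrite big_cons /= negb_and negbK => /orP[|/IHs->]; last first.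
  by rewrite mulr0.
move=> /splitPr[s1 s2]; rewrite big_cat big_cons /=.
by case: (word_move x s1 (W s2)) => ->; rewrite ?mulrN !mulrA ext_sqr0 !mul0r ?oppr0.
Qed.

Lemma word_perm (s t : seq T) : perm_eq s t -> W s = W t \/ W s = - W t.
Proof.
elim: s t => [|x s IHs] t pst.
  by move: pst; rewrite perm_sym => /perm_nilP->; left.
have /splitPr tx : x \in t by rewrite -(perm_mem pst) mem_head.
case: tx pst => t1 t2; rewrite perm_sym perm_catC /= perm_cons perm_catC perm_sym.
move=> /IHs; rewrite !big_cat !big_cons /=.
by case: (word_move x t1 (W t2)) => -> [] ->;
  rewrite ?mulrN ?opprK; [left|right|right|left].
Qed.

(** The contraction anticommutes with left multiplication by a vector on which [phi] vanishes. *)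
Lemma contraction_word (phi : M -> R) (h : L -> L) (s : seq T) (u : L) :
    {morph h : u v / u + v} ->
    (forall x u, h (io x * u) = sc (phi x) * u - io x * h u) ->
    {in s, forall x, phi (f x) = 0} ->
  h (W s * u) = W s * h u \/ h (W s * u) = - (W s * h u).
Proof.
move=> hD hM; have h0 : h 0 = 0 by apply: (@addIr _ (h 0)); rewrite -hD !add0r.
have hN v : h (- v) = - h v by apply: (@addIr _ (h v)); rewrite -hD !addNr.
elim: s => [|x s IHs] s0; first by rewrite big_nil !mul1r; left.
have [//||] := IHs; first by move=> y ys; rewrite s0 // inE ys orbT.
all: rewrite !big_cons -!mulrA hM s0 ?mem_head // rmorph0 mul0r add0r => ->.
  by right.
by left; rewrite mulrN opprK.
Qed.

End Words.

(** * Homogeneous parts of the exterior algebra *)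

Lemma ext_power_word q (a : R) (v : seq M) :
  size v = q -> ext_power q (sc a * \prod_(x <- v) io x).
Proof.
move=> <-; exists 1, (fun=> a), (fun _ j => v`_j).
by rewrite big_ord1 (big_nth 0) big_mkord.
Qed.

Lemma ext_power0 q : ext_power q (0 : L).
Proof. by exists 0, (fun=> 0), (fun _ _ => 0); rewrite big_ord0. Qed.

Lemma ext_powerD q (x y : L) :
  ext_power q x -> ext_power q y -> ext_power q (x + y).
Proof.
move=> [n [c [v ->]]] [n' [c' [v' ->]]].
exists (n + n')%N, (fun i => match split i with inl j => c j | inr j => c' j end),
  (fun i => match split i with inl j => v j | inr j => v' j end).
rewrite big_split_ord; congr (_ + _); apply: eq_bigr => i _.
  by rewrite -[lshift _ _]/(unsplit (inl _)) unsplitK.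
by rewrite -[rshift _ _]/(unsplit (inr _)) unsplitK.
Qed.

Lemma ext_power_ind q (P : L -> Prop) :
    P 0 -> (forall u v, P u -> P v -> P (u + v)) ->
    (forall a (v : seq M), size v = q -> P (sc a * \prod_(x <- v) io x)) ->
  forall u, ext_power q u -> P u.
Proof.
move=> P0 PD Pw u [n [c [v ->]]]; apply: big_ind => // i _.
have := Pw (c i) [seq v i j | j <- enum 'I_q].
by rewrite size_map size_enum_ord big_map prod_enum; apply.
Qed.

Lemma ext_powerZ q a (u : L) : ext_power q u -> ext_power q (sc a * u).
Proof.
elim/ext_power_ind: u / => [|u v IHu IHv|b v sv].
- by rewrite mulr0; apply: ext_power0.
- by rewrite mulrDr; apply: ext_powerD.
- by rewrite mulrA -rmorphM; apply: ext_power_word.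
Qed.

Lemma ext_powerN q (u : L) : ext_power q u -> ext_power q (- u).
Proof. by move=> /(ext_powerZ (-1)); rewrite rmorphN1 mulN1r. Qed.

Lemma ext_powerM q x (u : L) : ext_power q u -> ext_power q.+1 (io x * u).
Proof.
elim/ext_power_ind: u / => [|u v IHu IHv|b v sv].
- by rewrite mulr0; apply: ext_power0.
- by rewrite mulrDr; apply: ext_powerD.
- by have := @ext_power_word q.+1 b (x :: v); rewrite ext_scalCA big_cons /= sv; apply.
Qed.

Lemma ext_power_sum q (I : Type) (s : seq I) (P : pred I) (F : I -> L) :
  (forall i, P i -> ext_power q (F i)) -> ext_power q (\sum_(i <- s | P i) F i).
Proof. by move=> FP; apply: big_ind => //; [apply: ext_power0|apply: ext_powerD]. Qed.

Lemma ext_power_prefix (T : Type) (f : T -> M) (s : seq T) q (u : L) :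
  ext_power q u -> ext_power (size s + q) (\prod_(j <- s) io (f j) * u).
Proof.
move=> uq; elim: s => [|x s IHs]; first by rewrite big_nil mul1r.
by rewrite big_cons -mulrA; apply: ext_powerM.
Qed.

Lemma ext_power0P (u : L) : ext_power 0 u -> exists a, u = sc a.
Proof.
elim/ext_power_ind: u / => [|u v [a ->] [b ->]|b [] // _].
- by exists 0; rewrite rmorph0.
- by exists (a + b); rewrite rmorphD.
- by exists b; rewrite big_nil mulr1.
Qed.

Section ContractionPower.
Variables (phi : M -> R) (h : L -> L).
Hypotheses (hD : {morph h : u v / u + v}) (hZ : forall a u, h (sc a * u) = sc a * h u).
Hypotheses (h1 : h 1 = 0) (hM : forall x u, h (io x * u) = sc (phi x) * u - io x * h u).

Lemma contraction0 : h 0 = 0.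
Proof. by apply: (@addIr _ (h 0)); rewrite -hD !add0r. Qed.

Lemma contraction_scalar (u : L) : ext_power 0 u -> h u = 0.
Proof. by move=> /ext_power0P[a ->]; rewrite -[sc a]mulr1 hZ h1 mulr0. Qed.

Lemma contraction_power q (u : L) : ext_power q.+1 u -> ext_power q (h u).
Proof.
elim/ext_power_ind: u / => [|u v IHu IHv|a v sv].
- by rewrite contraction0; apply: ext_power0.
- by rewrite hD; apply: ext_powerD.
rewrite hZ; apply: ext_powerZ; elim: v q sv => // x v IHv q [sv].
have wv (w : seq M) : ext_power (size w) (\prod_(y <- w) io y : L).
  by have := ext_power_word 1 (erefl (size w)); rewrite rmorph1 mul1r.
rewrite big_cons hM; apply: ext_powerD; first by rewrite -sv; apply: ext_powerZ.
apply: ext_powerN; case: q sv => [/eqP/nilP->|q sv].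
  by rewrite big_nil h1 mulr0; apply: ext_power0.
exact/ext_powerM/IHv.
Qed.

End ContractionPower.
End ExteriorAlgebra.

(** * Congruences modulo an ideal and the filtration by products of given vectors *)

Definition is_ideal (R : comPzRingType) (I : set R) : Prop :=
  [/\ I 0, forall a b, I a -> I b -> I (a + b) & forall a b, I b -> I (a * b)].

Section Filtration.
Variables (R : comPzRingType) (M : lmodType R) (L : exteriorAlgebra M).

Local Notation sc := (ext_scal L).
Local Notation io := (ext_inj L).

Definition scalar_form (tau : L -> R) : Prop :=
  (forall u v, tau (u + v) = tau u + tau v) /\
  forall a u, tau (sc a * u) = a * tau u.

Lemma dual_basis m (e : 'I_m -> M) : is_basis e ->
  exists phi : 'I_m -> M -> R,
    (forall i, linear_for *%R (phi i)) /\ forall i j, phi i (e j) = (i == j)%:R.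
Proof.
move=> eB; have /choice[c cE] : forall x, exists c : {ffun 'I_m -> R},
    x = \sum_i c i *: e i by move=> x; have [c [cx _]] := eB x; exists c.
have cU x (d : {ffun 'I_m -> R}) : x = \sum_i d i *: e i -> c x = d.
  by move=> xd; have [d' [_ d'U]] := eB x; rewrite -(d'U _ xd) -(d'U _ (cE x)).
exists (fun i x => c x i); split=> [i a x y|i j].
  rewrite (cU _ [ffun i => a * c x i + c y i]) ?ffunE //.
  rewrite {1}(cE x) {1}(cE y) scaler_sumr -big_split; apply: eq_bigr => l _ /=.
  by rewrite ffunE scalerDl scalerA.
rewrite (cU _ [ffun i => (i == j)%:R]) ?ffunE // (bigD1 j) //= ffunE eqxx scale1r.
by rewrite big1 ?addr0 // => l /negPf lj; rewrite ffunE lj scale0r.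
Qed.

(** Contract by the dual functionals one after the other, then apply the augmentation. This form is
    the source of the linear independence of the products of basis vectors. *)
Lemma volume_form m (e : 'I_m -> M) (s : seq 'I_m) : is_basis e -> uniq s ->
  exists tau : L -> R, scalar_form tau /\ tau (\prod_(j <- s) io (e j)) = 1.
Proof.
move=> /dual_basis[phi [phiL phiE]]; elim: s => [_|i s IHs /= /andP[is_ us]].
  have [eps epsE] := augmentation L; exists eps; split; last first.
    by rewrite big_nil rmorph1.
  by split=> [u v|a u]; rewrite ?rmorphD // rmorphM epsE.
have [tau [[tauD tauZ] tau1]] := IHs us.
have [h [hD hZ h1 hM]] := @contraction R M L _ (phiL i).
exists (tau \o h); split.
  by split=> [u v|a u] /=; rewrite ?hD ?hZ ?tauD ?tauZ.
rewrite /= big_cons hM phiE eqxx rmorph1 mul1r.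
suff -> : h (\prod_(j <- s) io (e j)) = 0 by rewrite mulr0 subr0.
rewrite -[X in h X]mulr1.
have phi0 : {in s, forall j, phi i (e j) = 0}.
  by move=> j js; rewrite phiE; case: eqP js is_ => // -> ->.
by have [->|->] := contraction_word 1 hD hM phi0; rewrite h1 mulr0 ?oppr0.
Qed.

(** The extension I L. Congruence modulo I is stated as membership of a difference, so that no
    quotient of [R] or [L] is formed. *)
Inductive ideal_ext (I : set R) : L -> Prop :=
| IdealExt0 : ideal_ext I 0
| IdealExtD u v : ideal_ext I u -> ideal_ext I v -> ideal_ext I (u + v)
| IdealExtM a u : I a -> ideal_ext I (sc a * u).

Lemma ideal_extMl I v u : ideal_ext I u -> ideal_ext I (v * u).
Proof.
elim=> [|u1 u2 _ IH1 _ IH2|a u1 Ia].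
- by rewrite mulr0; apply: IdealExt0.
- by rewrite mulrDr; apply: IdealExtD.
- by rewrite ext_scalCA; apply: IdealExtM.
Qed.

Lemma ideal_extN I u : ideal_ext I u -> ideal_ext I (- u).
Proof. by rewrite -mulN1r; apply: ideal_extMl. Qed.

Lemma ideal_extB I u v : ideal_ext I u -> ideal_ext I v -> ideal_ext I (u - v).
Proof. by move=> Iu Iv; apply/IdealExtD/ideal_extN. Qed.

Lemma ideal_ext_sub I J u : I `<=` J -> ideal_ext I u -> ideal_ext J u.
Proof. by move=> IJ; elim=> *; [exact: IdealExt0|exact: IdealExtD|exact/IdealExtM/IJ]. Qed.

Lemma ideal_ext_sum I (A : Type) (s : seq A) (P : pred A) (F : A -> L) :
  (forall i, P i -> ideal_ext I (F i)) -> ideal_ext I (\sum_(i <- s | P i) F i).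
Proof. by move=> FP; apply: big_ind => //; [apply: IdealExt0|apply: IdealExtD]. Qed.

Lemma ideal_ext_contraction I h u :
    {morph h : u v / u + v} -> (forall a u, h (sc a * u) = sc a * h u) ->
  ideal_ext I u -> ideal_ext I (h u).
Proof.
move=> hD hZ; elim=> [|u1 u2 _ IH1 _ IH2|a u1 Ia].
- by rewrite (contraction0 hD); apply: IdealExt0.
- by rewrite hD; apply: IdealExtD.
- by rewrite hZ; apply: IdealExtM.
Qed.

Lemma scalar_form_ideal_ext I tau u :
  is_ideal I -> scalar_form tau -> ideal_ext I u -> I (tau u).
Proof.
move=> [I0 ID IM] [tauD tauZ]; elim=> [|u1 u2 _ IH1 _ IH2|a u1 Ia].
- by rewrite (_ : tau 0 = 0) //; apply: (@addIr _ (tau 0)); rewrite -tauD !add0r.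
- by rewrite tauD; apply: ID.
- by rewrite tauZ mulrC; apply: IM.
Qed.

Lemma ideal_ext0 u : ideal_ext [set 0] u -> u = 0.
Proof.
by elim=> [//|u1 u2 _ -> _ ->|a u1 ->]; rewrite ?addr0 // rmorph0 mul0r.
Qed.

Section Fil.
Variables (T : eqType) (f : T -> M) (I : set R).
Local Notation W s := (\prod_(j <- s) io (f j)).

(* The submodule of the p-th exterior power generated by the products of r of the
   vectors f x, x in w, by elements of degree p - r (0 if p < r), enlarged by I L. *)
Inductive fil (w : seq T) : nat -> nat -> L -> Prop :=
| FilExt p u : ext_power p u -> fil w 0 p u
| FilIdeal r p u : ideal_ext I u -> fil w r p u
| FilD r p u v : fil w r p u -> fil w r p v -> fil w r p (u + v)
| FilM r p x u : x \in w -> fil w r p u -> fil w r.+1 p.+1 (io (f x) * u).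

Lemma filZ w r p a u : fil w r p u -> fil w r p (sc a * u).
Proof.
elim=> {r p u} [p u pu|r p u Iu|r p u v _ IHu _ IHv|r p x u xw _ IH].
- exact/FilExt/ext_powerZ.
- by apply/FilIdeal/ideal_extMl.
- by rewrite mulrDr; apply: FilD.
- by rewrite -ext_scalCA; apply: FilM.
Qed.

Lemma filN w r p u : fil w r p u -> fil w r p (- u).
Proof. by move=> /(filZ (-1)); rewrite rmorphN1 mulN1r. Qed.

Lemma fil_sum w r p (A : Type) (s : seq A) (P : pred A) (F : A -> L) :
  (forall i, P i -> fil w r p (F i)) -> fil w r p (\sum_(i <- s | P i) F i).
Proof.
by move=> FP; apply: big_ind => //; [apply/FilIdeal/IdealExt0|apply: FilD].
Qed.

Lemma fil_subset w w' r p u : {subset w <= w'} -> fil w r p u -> fil w' r p u.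
Proof.
move=> ww'; elim=> {r p u} *; [exact: FilExt|exact: FilIdeal|exact: FilD|].
by apply: FilM => //; apply: ww'.
Qed.

Lemma fil_word w s r q u : {subset s <= w} -> (r <= size s)%N ->
  ext_power q u -> fil w r (size s + q) (W s * u).
Proof.
move=> sw rs uq; elim: s r sw rs => [|x s IHs] [|r] // sw rs.
- by rewrite big_nil mul1r; apply: FilExt.
- exact/FilExt/ext_power_prefix.
rewrite big_cons -mulrA; apply: FilM; first exact/sw/mem_head.
by apply: IHs => // y ys; apply: sw; rewrite inE ys orbT.
Qed.

Lemma fil_wordM w s r q u : {subset s <= w} ->
  fil w r q u -> fil w (size s + r) (size s + q) (W s * u).
Proof.
move=> sw ru; elim: s sw => [|x s IHs] sw; first by rewrite big_nil mul1r.
rewrite big_cons -mulrA; apply: FilM; first exact/sw/mem_head.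
by apply: IHs => // y ys; apply: sw; rewrite inE ys orbT.
Qed.

(** [FilM] lowers [r] and [p] together and [FilExt] requires [r = 0], so every leaf of the
    derivation is a [FilIdeal]. *)
Lemma fil_gt w r p u : (p < r)%N -> fil w r p u -> ideal_ext I u.
Proof.
move=> + F; elim: F => {r p u} // [r p u v _ IHu _ IHv|r p x u _ _ IH] pr.
  by apply: IdealExtD; [apply: IHu|apply: IHv].
exact/ideal_extMl/IH.
Qed.

Lemma fil_degree0 w r p u : p = 0%N -> fil w r p u -> exists a, ideal_ext I (u - sc a).
Proof.
move=> + F; elim: F => {r p u} [p u ep p0|r p u Iu _|
  r p u v _ IHu _ IHv p0|//].
- have [|a ->] := @ext_power0P _ _ L u; first by rewrite -p0.
  by exists a; rewrite subrr; apply: IdealExt0.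
- by exists 0; rewrite rmorph0 subr0.
have [[a ua] [b vb]] := (IHu p0, IHv p0).
by exists (a + b); rewrite rmorphD opprD addrACA; apply: IdealExtD.
Qed.

(** Up to sign, the contraction passes through the [r] factors on the left, on which [phi] vanishes,
    and lowers the degree of what follows. *)
Lemma fil_contraction w r p phi h u :
    {morph h : u v / u + v} -> (forall a u, h (sc a * u) = sc a * h u) ->
    h 1 = 0 -> (forall x u, h (io x * u) = sc (phi x) * u - io x * h u) ->
    {in w, forall x, phi (f x) = 0} ->
  fil w r p.+1 u -> fil w r p (h u).
Proof.
move=> hD hZ h1 hM phi0 F; move pE: p.+1 F => p' F; 
elim: F p pE => {r p' u} [p' u pu|r p' u Iu|
  r p' u v _ IHu _ IHv|r p' x u xw F IH] p pp'.
- by apply: FilExt; apply: (contraction_power hD hZ h1 hM); rewrite pp'.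
- exact/FilIdeal/ideal_ext_contraction.
- by rewrite hD; apply: FilD; [apply: IHu|apply: IHv].
rewrite hM phi0 // rmorph0 mul0r add0r; apply: filN.
case: pp' => pp'; subst p'.
case: p F IH => [|p] F IH; last by apply: FilM => //; apply: IH.
(* In degree 0, [u] is a scalar modulo I and [h] kills scalars, so [h u] lies in I L. *)
have [a ua] := fil_degree0 erefl F; apply/FilIdeal/ideal_extMl.
have := ideal_ext_contraction hD hZ ua; rewrite hD -rmorphN.
by rewrite -[sc (- a)]mulr1 hZ h1 mulr0 addr0.
Qed.

(* The functionals phi of the successive vectors of w have a triangular matrix
   of values phi_i (f x_j), with a on the diagonal. *)
Fixpoint triangular_dual (a : R) (w : seq T) : Prop :=
  if w is x :: w' then
    (exists phi : M -> R, [/\ linear_for *%R phi, phi (f x) = a &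
       {in w', forall y, phi (f y) = 0}]) /\ triangular_dual a w'
  else True.

(* With h the contraction by the functional dual to the first vector x,
   a eta = h (x eta) + x (h eta), and induction on w applies to x eta and h eta. *)
Lemma fil_annihilated a w s r p eta : triangular_dual a w ->
    (r + s = (size w).+1)%N -> ext_power p eta ->
    (forall t : seq T, size t = s -> {subset t <= w} -> ideal_ext I (W t * eta)) ->
  fil w r p (sc (a ^+ size w) * eta).
Proof.
elim: w s r p eta => [|x w IHw] s r p eta /=.
  case: s => [_ _ _ /(_ [::] erefl)|s _ rs ep _].
    by rewrite big_nil mul1r => H; apply/filZ/FilIdeal; apply: H.
  have -> : r = 0%N by move: rs; rewrite addnS => -[]; case: r.
  exact/filZ/FilExt.
move=> [[phi [phiL phix phi0]] dual] rs ep B.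
case: r rs => [|r] rs; first exact/filZ/FilExt.
case: s rs B => [|s] rs B.
  by have := B [::] erefl; rewrite big_nil mul1r => H; apply/filZ/FilIdeal; apply: H.
have [h [hD hZ h1 hM]] := @contraction R M L _ phiL.
have xw : {subset w <= x :: w} by move=> y yw; rewrite inE yw orbT.
have -> : sc (a ^+ (size w).+1) * eta =
    h (sc (a ^+ size w) * (io (f x) * eta)) + io (f x) * (sc (a ^+ size w) * h eta).
  by rewrite hZ hM phix ext_scalCA -mulrDr subrK exprSr rmorphM mulrA.
(* In the first term [s] drops by one, since a word followed by [x] is one letter longer; in the
   second [r] drops by one and [FilM] restores the factor. *)
apply: FilD.
  apply/(fil_subset xw)/(fil_contraction hD hZ h1 hM phi0).
  apply: (IHw s) => //; [lia|exact: ext_powerM|move=> t st tw].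
  have := B (rcons t x); rewrite size_rcons st -cats1 big_cat big_seq1 -mulrA.
  apply=> // y; rewrite mem_cat inE => /orP[/tw/xw//|/eqP->]; exact: mem_head.
case: p ep => [|p] ep.
  by rewrite (contraction_scalar hZ h1 ep) !mulr0; apply/FilIdeal/IdealExt0.
apply: FilM; first exact: mem_head.
apply/(fil_subset xw)/(IHw s.+1) => //; first lia.
  exact: (contraction_power hD hZ h1 hM).
move=> t st tw; have := B t st (fun y yt => xw y (tw y yt)).
move=> /(ideal_ext_contraction hD hZ).
have phit0 : {in t, forall y, phi (f y) = 0} by move=> y yt; apply/phi0/tw.
have [->//|->] := contraction_word eta hD hM phit0.
by move=> /ideal_extN; rewrite opprK.
Qed.

(** Cramer's rule: the functional of [x] replaces [f x] by its argument inside the full product and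
    applies [tau]. At a later vector of the list the product has a repeated factor and vanishes. *)
Lemma triangular_dual_minor tau (w1 w2 : seq T) : scalar_form tau ->
  uniq (w1 ++ w2) -> triangular_dual (tau (W (w1 ++ w2))) w2.
Proof.
move=> [tauD tauZ]; elim: w2 w1 => //= x w2 IHw w1 uw; split; last first.
  by rewrite -cat_rcons; apply: IHw; rewrite cat_rcons.
exists (fun y => tau (W w1 * (io y * W w2))); split.
- move=> a y z; rewrite linearP /= mulrDl mulrDr tauD -mulrA ext_scalCA.
  by rewrite tauZ.
- by rewrite big_cat big_cons.
move=> y yw; have := @word_repeat R M L T f (w1 ++ y :: w2).
rewrite big_cat big_cons => ->; last first.
  by rewrite cat_uniq /= yw !andbF.
by apply: (@addIr _ (tau 0)); rewrite -tauD !add0r.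
Qed.

End Fil.
End Filtration.

(** * Generated ideals *)

Section GeneratedIdeal.
Variable R : comPzRingType.
Implicit Types (S I : set R) (a : seq R).

Lemma gen_ideal_is_ideal S : is_ideal (gen_ideal S).
Proof.
split=> [|x y|b x].
- by exists 0%N, (fun=> 0), (fun=> 0); split; [case|rewrite big_ord0].
- move=> [n [c [g [Sg ->]]]] [n' [c' [g' [Sg' ->]]]].
  exists (n + n')%N,
    (fun i => match split i with inl j => c j | inr j => c' j end),
    (fun i => match split i with inl j => g j | inr j => g' j end).
  split; first by move=> i; case: (split i).
  rewrite big_split_ord; congr (_ + _); apply: eq_bigr => i _.
    by rewrite -[lshift _ _]/(unsplit (inl _)) unsplitK.
  by rewrite -[rshift _ _]/(unsplit (inr _)) unsplitK.
- move=> [n [c [g [Sg ->]]]]; exists n, (fun i => b * c i), g; split=> //.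
  by rewrite mulr_sumr; apply: eq_bigr => i _; rewrite mulrA.
Qed.

Lemma gen_ideal_min S I : is_ideal I -> S `<=` I -> gen_ideal S `<=` I.
Proof.
move=> [I0 ID IM] SI x [n [c [g [Sg ->]]]].
by apply: big_ind => // i _; apply/IM/SI.
Qed.

Lemma gen_ideal_mem S x : S x -> gen_ideal S x.
Proof.
move=> Sx; exists 1%N, (fun=> 1), (fun=> x); split=> //.
by rewrite big_ord1 mul1r.
Qed.

Lemma ideal0 : is_ideal [set 0 : R].
Proof. by split=> [//|a b -> ->|a b ->] /=; rewrite ?addr0 ?mulr0. Qed.

Lemma gen_ideal_nil : gen_ideal [set` [::] : seq R] `<=` [set 0].
Proof. by apply: gen_ideal_min => //; apply: ideal0. Qed.

Lemma gen_ideal_takeS a i x : (i < size a)%N ->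
  gen_ideal [set` take i.+1 a] x ->
  exists d, gen_ideal [set` take i a] (x - a`_i * d).
Proof.
move=> ia; have [G0 GD GM] := gen_ideal_is_ideal [set` take i a].
apply: (@gen_ideal_min _ (fun x => exists d, _ (x - a`_i * d))) => [|y].
  split=> [|y z [d yd] [d' zd]|b y [d yd]].
  - by exists 0; rewrite mulr0 subr0.
  - by exists (d + d'); rewrite mulrDr opprD addrACA; apply: GD.
  - by exists (b * d); rewrite mulrCA -mulrBr; apply: GM.
rewrite /= (take_nth 0 ia) mem_rcons inE => /orP[/eqP->|ya].
  by exists 1; rewrite mulr1 subrr.
by exists 0; rewrite mulr0 subr0; apply: gen_ideal_mem.
Qed.

Lemma gen_ideal_take_mono a i :
  gen_ideal [set` take i a] `<=` gen_ideal [set` take i.+1 a].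
Proof.
apply: gen_ideal_min; first exact: gen_ideal_is_ideal.
move=> x /= xa; apply: gen_ideal_mem => /=.
have [ia|ai] := ltnP i (size a).
  by rewrite (take_nth 0 ia) mem_rcons inE xa orbT.
by move: xa; rewrite !take_oversize // ltnW.
Qed.

(** Pigeonhole on exponents: in each binomial term either the first summand occurs at least [k]
    times, or the remaining sum occurs often enough for induction. *)
Lemma ideal_expr_sum I (A : eqType) (s : seq A) (d x : A -> R) k :
    is_ideal I -> {in s, forall i, I (x i ^+ k)} ->
  I ((\sum_(i <- s) d i * x i) ^+ (size s * k).+1).
Proof.
move=> [I0 ID IM] Ix; elim: s Ix => [|i s IHs] Ix; first by rewrite big_nil expr1.
rewrite big_cons exprDn; apply: big_ind => // -[j /= j_lt] _.
rewrite -mulr_natl; apply/IM.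
have [jk|jk] := ltnP (size s * k) j.
  rewrite -(subnK jk) exprD mulrA; apply/IM/IHs => l ls.
  by apply: Ix; rewrite inE ls orbT.
have kj : (k <= ((size s).+1 * k).+1 - j)%N.
  by rewrite leq_subRL ?(leq_trans jk) // mulSn; lia.
by rewrite exprMn mulrC -(subnK kj) [x i ^+ _]exprD !mulrA; apply/IM/Ix/mem_head.
Qed.

End GeneratedIdeal.

(** * Multiindices and their complements *)

Section Multiindices.

Lemma multiindex_uniq r k (J : r.-tuple 'I_k) : J \in multiindices r k -> uniq J.
Proof.
by rewrite inE => /(sorted_uniq ltn_trans ltnn); rewrite (map_inj_uniq val_inj).
Qed.

Lemma multiindex_sort r k (s : seq 'I_k) : uniq s -> size s = r ->
  exists2 J : r.-tuple 'I_k, J \in multiindices r k & perm_eq s J.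
Proof.
move=> us sr; pose e := relpre (val : 'I_k -> nat) leq.
have sz : size (sort e s) == r by rewrite size_sort sr.
exists (Tuple sz); last by rewrite perm_sym perm_sort.
rewrite inE ltn_sorted_uniq_leq (map_inj_uniq val_inj) sort_uniq us sorted_map.
by apply: sort_sorted => i j; apply: leq_total.
Qed.

Lemma multiindex_eq r k (J J' : r.-tuple 'I_k) :
  J \in multiindices r k -> J' \in multiindices r k -> J =i J' -> J = J'.
Proof.
rewrite !inE => sJ sJ' JJ'; apply/val_inj/(inj_map val_inj).
apply: (irr_sorted_eq ltn_trans ltnn sJ sJ') => i.
by apply/mapP/mapP => -[j jJ ->]; exists j => //; rewrite ?JJ' // -JJ'.
Qed.

(** The complementary multiindex: multiplication by its wedge isolates the coefficient of [J]. *)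
Definition cofactor_index r k (J : r.-tuple 'I_k) : seq 'I_k :=
  [seq j <- enum 'I_k | j \notin J].

Lemma cofactor_index_perm r k (J : r.-tuple 'I_k) : J \in multiindices r k ->
  perm_eq (cofactor_index J ++ J) (enum 'I_k).
Proof.
move=> /multiindex_uniq uJ; rewrite perm_sym -(perm_filterC [in J]) perm_catC.
rewrite perm_cat2l; apply: uniq_perm; rewrite ?(filter_uniq _ (enum_uniq _)) // => i.
by rewrite mem_filter mem_enum andbT.
Qed.

(** A multiindex disjoint from the complement of [J] is contained in [J], and equal length forces
    equality. *)
Lemma cofactor_index_repeat r k (J J' : r.-tuple 'I_k) :
    J \in multiindices r k -> J' \in multiindices r k -> J' != J ->
  ~~ uniq (cofactor_index J ++ J').
Proof.
move=> mJ mJ'; apply: contra; rewrite cat_uniq => /and3P[_ /hasPn disj uJ'].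
have sub : {subset J' <= J}.
  move=> i /disj; rewrite mem_filter mem_enum andbT.
  by rewrite negbK.
have szJ : (size J <= size J')%N by rewrite !size_tuple.
have [_ JJ'] := uniq_min_size uJ' sub szJ.
by apply/eqP/multiindex_eq.
Qed.

End Multiindices.

(** * Explicit representations and their relation to the filtration *)

Section Representable.
Variables (R : comPzRingType) (M : lmodType R) (L : exteriorAlgebra M).
Variables (k : nat) (omega : 'I_k -> M).

Local Notation sc := (ext_scal L).
Local Notation io := (ext_inj L).
Local Notation W s := (\prod_(j <- s) io (omega j)).

Lemma representable0 p r : representable omega p r (0 : L).
Proof.
by exists (fun=> 0); split=> [J|]; [apply: ext_power0|rewrite big1// => J _; rewrite mulr0].
Qed.

Lemma representableD p r (u v : L) : representable omega p r u ->
  representable omega p r v -> representable omega p r (u + v).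
Proof.
move=> [g [gp ->]] [g' [gp' ->]]; exists (fun J => g J + g' J); split=> [J|].
  exact: ext_powerD.
by rewrite -big_split; apply: eq_bigr => J _; rewrite mulrDr.
Qed.

Lemma representableZ p r a (u : L) :
  representable omega p r u -> representable omega p r (sc a * u).
Proof.
move=> [g [gp ->]]; exists (fun J => sc a * g J); split=> [J|].
  exact/ext_powerZ/gp.
by rewrite mulr_sumr; apply: eq_bigr => J _; rewrite ext_scalCA.
Qed.

Lemma representable_sum p r (A : Type) (s : seq A) (P : pred A) (F : A -> L) :
  (forall i, P i -> representable omega p r (F i)) ->
  representable omega p r (\sum_(i <- s | P i) F i).
Proof.
by move=> FP; apply: big_ind => //; [apply: representable0|apply: representableD].
Qed.

(** A word with a repetition vanishes; any other is sorted into a multiindex, and the sign is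
    absorbed by the coefficient. *)
Lemma representable_word p (s : seq 'I_k) (g : L) :
  ext_power (p - size s) g -> representable omega p (size s) (W s * g).
Proof.
move=> gp; have [us|/(word_repeat L omega)->] := boolP (uniq s); last first.
  by rewrite mul0r; apply: representable0.
have [J mJ sJ] := multiindex_sort us erefl.
suff H (g' : L) : ext_power (p - size s) g' ->
    representable omega p (size s) (wedge L omega J * g').
  have [->|->] := word_perm L omega sJ; first exact: H.
  by rewrite mulNr -mulrN; apply/H/ext_powerN.
move=> gp'; exists (fun J' => if J' == J then g' else 0); split=> [J'|].
  by case: eqP => // _; apply: ext_power0.
rewrite (bigD1 J) //= eqxx big1 ?addr0 // => J' /andP[_ /negPf->].
by rewrite mulr0.
Qed.

Lemma representable_cons p r x (u : L) : representable omega p r u ->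
  representable omega p.+1 r.+1 (io (omega x) * u).
Proof.
move=> [g [gp ->]]; rewrite mulr_sumr; apply: representable_sum => J _.
have := @representable_word p.+1 (x :: J) (g J).
by rewrite big_cons -mulrA /= size_tuple subSS; apply.
Qed.

Lemma representable_ext_power p r (u : L) : (r <= p)%N ->
  representable omega p r u -> ext_power p u.
Proof.
move=> rp [g [gp ->]]; apply: ext_power_sum => J _; rewrite -(subnKC rp).
by rewrite -{1}(size_tuple J); apply: ext_power_prefix.
Qed.

Lemma representable_fil I p r (u : L) : (r <= p)%N ->
  representable omega p r u -> fil omega I (enum 'I_k) r p u.
Proof.
move=> rp [g [gp ->]]; apply: fil_sum => J _; rewrite -{1}(subnKC rp).
rewrite -{2}(size_tuple J); apply: fil_word; rewrite ?size_tuple //.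
by move=> j _; rewrite mem_enum.
Qed.

(** With the zero ideal this turns membership in the filtration into the sums of the theorem. *)
Lemma fil_representable I w p r (u : L) : (r <= p)%N -> fil omega I w r p u ->
  exists2 v, representable omega p r v & ideal_ext I (u - v).
Proof.
move=> + F; elim: F => {r p u} [p u pu|r p u Iu|r p u v _ IHu _ IHv|r p x u xw _ IH] rp.
- exists u; last by rewrite subrr; apply: IdealExt0.
  by have := @representable_word p [::] u; rewrite subn0 big_nil mul1r; apply.
- by exists 0; [apply: representable0|rewrite subr0].
- have [u' ru' uu'] := IHu rp; have [v' rv' vv'] := IHv rp.
  exists (u' + v'); first exact: representableD.
  by rewrite opprD addrACA; apply: IdealExtD.
- have [v rv uv] := IH rp; exists (io (omega x) * v).
    exact: representable_cons.
  by rewrite -mulrBr; apply: ideal_extMl.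
Qed.

Lemma cofactor_sum r (g : r.-tuple 'I_k -> L) J : J \in multiindices r k ->
  W (cofactor_index J) * (\sum_(J' in multiindices r k) wedge L omega J' * g J') =
  W (cofactor_index J ++ J) * g J.
Proof.
move=> mJ; rewrite mulr_sumr (bigD1 J) //= [X in _ + X]big1 ?addr0.
  by rewrite big_cat mulrA.
move=> J' /andP[mJ' J'J]; rewrite mulrA.
have := word_repeat L omega (cofactor_index_repeat mJ mJ' J'J).
by rewrite big_cat => ->; rewrite mul0r.
Qed.

Lemma condB_word s (eta : L) (t : seq 'I_k) :
  condB omega s eta -> size t = s -> W t * eta = 0.
Proof.
move=> B st; have [ut|/(word_repeat L omega)->] := boolP (uniq t); last exact: mul0r.
have [J mJ sJ] := multiindex_sort ut st.
by have [->|->] := word_perm L omega sJ; rewrite ?mulNr B ?oppr0.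
Qed.

End Representable.

(** * Coordinates with respect to a basis *)

Section Basis.
Variables (R : comPzRingType) (M : lmodType R) (L : exteriorAlgebra M).
Variables (m : nat) (e : 'I_m -> M).
Hypothesis e_basis : is_basis e.

Local Notation sc := (ext_scal L).
Local Notation io := (ext_inj L).

Lemma ext_power_basis q (u : L) : ext_power q u -> exists c : q.-tuple 'I_m -> R,
  (* The lemmas on [representable] are reused with [e] in place of the omega's and [r = p = q], so
     the coefficients have degree 0 and are scalars. *)
  u = \sum_(J in multiindices q m) sc (c J) * wedge L e J.
Proof.
move=> uq; have {uq} [g [g0 ->]] : representable e q q u.
  elim/ext_power_ind: u / uq => [|u v|a v]; [exact: representable0|exact: representableD|].
  elim: v q => [|x v IHv] q <- /=.
    have := @representable_word R M L _ e 0 [::] (sc a * \prod_(j <- [::]) io (e j)).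
    rewrite !big_nil mul1r; apply.
    by have := ext_power_word L a (erefl (@size M [::])); rewrite big_nil.
  have [c [-> _]] := e_basis x; rewrite big_cons linear_sum mulr_suml.
  rewrite mulr_sumr; apply: representable_sum => i _.
  rewrite ext_injZ -mulrA ext_scalCA -(ext_scalCA a).
  exact/representableZ/representable_cons/IHv.
have /choice[c cE] : forall J, exists a, g J = sc a.
  by move=> J; apply: ext_power0P; have := g0 J; rewrite subnn.
by exists c; apply: eq_bigr => J _; rewrite cE ext_scalC.
Qed.

(** Multiply by the complementary basis vectors and apply the volume form; [b] corrects the sign.
    This gives the uniqueness of coefficients. *)
Lemma coefficient_form q (J : q.-tuple 'I_m) : J \in multiindices q m ->
  exists sigma : L -> R, scalar_form sigma /\ forall c : q.-tuple 'I_m -> R,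
    sigma (\sum_(J' in multiindices q m) sc (c J') * wedge L e J') = c J.
Proof.
move=> mJ; have [tau [[tauD tauZ] tau1]] := volume_form L e_basis (enum_uniq 'I_m).
have tauN u : tau (- u) = - tau u.
  by rewrite -mulN1r -(rmorphN1 sc) tauZ mulN1r.
have sJ := cofactor_index_perm mJ.
have [b b1] : exists b : R, b * tau (\prod_(j <- cofactor_index J ++ J) io (e j)) = 1.
  have [->|->] := word_perm L e sJ; first by exists 1; rewrite mul1r tau1.
  by exists (- 1); rewrite tauN tau1 mulrNN mulr1.
exists (fun u => b * tau (\prod_(j <- cofactor_index J) io (e j) * u)); split.
  split=> [u v|a u]; first by rewrite mulrDr tauD mulrDr.
  by rewrite ext_scalCA tauZ mulrCA.
move=> c; rewrite (eq_bigr (fun J' => wedge L e J' * sc (c J'))); last first.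
  by move=> J' _; rewrite ext_scalC.
by rewrite (cofactor_sum e (fun J => sc (c J)) mJ) -ext_scalC tauZ mulrCA b1 mulr1.
Qed.

Lemma ideal_ext_coefficient I q (c : q.-tuple 'I_m -> R) J :
    is_ideal I -> J \in multiindices q m ->
  ideal_ext I (\sum_(J' in multiindices q m) sc (c J') * wedge L e J') -> I (c J).
Proof.
move=> idI mJ Iu; have [sigma [sf sE]] := coefficient_form mJ.
by rewrite -[c J]sE; apply: (scalar_form_ideal_ext idI sf).
Qed.

Lemma ext_power_wedge q (J : q.-tuple 'I_m) : ext_power q (wedge L e J).
Proof.
have := @ext_power_prefix R M L _ e J 0 1; rewrite size_tuple addn0 mulr1; apply.
by have := ext_power_word L 1 (erefl (@size M [::])); rewrite big_nil rmorph1 mul1r.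
Qed.

(** A non-zero-divisor modulo I can be cancelled coefficient by coefficient. *)
Lemma ideal_ext_regular I q x (u : L) : is_ideal I ->
    (forall y, I (x * y) -> I y) -> ext_power q u ->
  ideal_ext I (sc x * u) -> ideal_ext I u.
Proof.
move=> idI nzd /ext_power_basis[c ->]; rewrite mulr_sumr.
under eq_bigr do rewrite mulrA -rmorphM.
move=> Iu; apply: ideal_ext_sum => J mJ; apply/IdealExtM/nzd.
exact: (ideal_ext_coefficient (c := fun J => x * c J)) Iu.
Qed.

Lemma ideal_ext_split I I' q x (u : L) : is_ideal I' ->
    (forall y, I' y -> exists d, I (y - x * d)) ->
    ext_power q u -> ideal_ext I' u ->
  exists2 v, ext_power q v & ideal_ext I (u - sc x * v).
Proof.
move=> idI' sp /ext_power_basis[c ->] Iu.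
have /choice[d dE] : forall J, exists d, J \in multiindices q m -> I (c J - x * d).
  move=> J; have [mJ|_] := boolP (J \in multiindices q m); last by exists 0.
  by have [d Id] := sp _ (ideal_ext_coefficient idI' mJ Iu); exists d.
exists (\sum_(J in multiindices q m) sc (d J) * wedge L e J).
  by apply: ext_power_sum => J _; apply/ext_powerZ/ext_power_wedge.
rewrite mulr_sumr -sumrB; apply: ideal_ext_sum => J mJ.
by rewrite mulrA -mulrBl -rmorphM -rmorphB; apply/IdealExtM/dE.
Qed.

End Basis.

(** * Regular sequences from the depth inequality *)

Section Depth.
Variable R : comPzRingType.

Lemma depth_regular_seq (I : set R) (d : nat) :
  ((d%:Z)%:E <= depth I - 2%:E)%E -> I <> setT ->
  exists a : seq R, [/\ regular_seq a, [set` a] `<=` I & (d + 2 <= size a)%N].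
Proof.
move=> + IT; rewrite /depth; case: asboolP => // _.
set A := [set _ | _ in _] => dA; apply: contrapT => noseq.
(* If all lengths were at most d + 1, the depth minus 2 would be less than d. *)
have ub : ubound A ((d + 1)%:Z)%:E.
  move=> _ [a [ra aI] <-]; rewrite lee_fin lez_nat leqNgt; apply/negP => da.
  by apply: noseq; exists a; split=> //; rewrite addn2 -addn1.
have : (supremum 0%E A <= ((d + 1)%:Z)%:E)%E.
  (* The default value 0 of [supremum] also respects the bound. *)
  rewrite /supremum; case: ifP => // _.
  by case: xgetP => // x _ [_]; apply.
move: dA; case: (supremum _ _) => [x| |] //=.
by rewrite !lee_fin => dx xd; lia.
Qed.

End Depth.

(** * Powers of elements of the coefficient ideal *)

Section Main.
Variables (R : comPzRingType) (M : lmodType R) (L : exteriorAlgebra M).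
Variables (m : nat) (e : 'I_m -> M).
Hypothesis e_basis : is_basis e.
Variables (k : nat) (omega : 'I_k -> M).

Local Notation sc := (ext_scal L).
Local Notation io := (ext_inj L).
Local Notation W s := (\prod_(j <- s) io (omega j)).
Local Notation Omega := (\prod_(j < k) io (omega j)).
Local Notation IOmega := (coef_ideal e k Omega).
Local Notation fil I := (fil (L := L) omega I (enum 'I_k)).
Local Notation gen a i := (gen_ideal [set` take i a]).

(** The pigeonhole exponent for the coefficients of Omega, each of which acts through its [k]-th
    power; it depends on [m] and [k] alone. *)
Definition annihilation_exponent := (#|multiindices k m| * k).+1.

Lemma coef_ideal_expr I r s p a (eta : L) : is_ideal I -> IOmega a ->
    (r + s = k + 1)%N -> ext_power p eta ->
    (forall t : seq 'I_k, size t = s -> ideal_ext I (W t * eta)) ->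
  fil I r p (sc (a ^+ annihilation_exponent) * eta).
Proof.
move=> idI [c [OmegaE Ia]] rs ep B.
(* The multipliers bringing [eta] into the filtration form an ideal, so it suffices that it contains
   the [k]-th powers of the coefficients. *)
have idP : is_ideal (fun b => fil I r p (sc b * eta)).
  split=> [|x y Fx Fy|x y Fy].
  - by rewrite rmorph0 mul0r; apply/FilIdeal/IdealExt0.
  - by rewrite rmorphD mulrDl; apply: FilD.
  - by rewrite rmorphM -mulrA; apply: filZ.
have minor J : J \in multiindices k m -> fil I r p (sc (c J ^+ k) * eta).
  (* The value of [sigma] at Omega is [c J], which becomes the diagonal value in Cramer's rule. *)
  move=> mJ; have [sigma [sf sE]] := coefficient_form L e_basis mJ.
  have := triangular_dual_minor omega (w1 := [::]) sf (enum_uniq 'I_k).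
  rewrite /= prod_enum OmegaE sE => dual.
  have := fil_annihilated (s := s) (r := r) dual; rewrite size_enum_ord.
  apply => // [|t st _]; [lia|exact: B].
have [d ->] : exists d : k.-tuple 'I_m -> R,
    a = \sum_(J <- enum (multiindices k m)) d J * c J.
  move: a Ia; apply: gen_ideal_min.
    split=> [|x y [d ->] [d' ->]|x y [d ->]].
    - by exists (fun=> 0); rewrite big1 // => J _; rewrite mul0r.
    - exists (fun J => d J + d' J); rewrite -big_split; apply: eq_bigr => J _.
      by rewrite mulrDl.
    - exists (fun J => x * d J); rewrite mulr_sumr; apply: eq_bigr => J _.
      by rewrite mulrA.
  move=> _ [J mJ <-]; exists (fun J' => (J' == J)%:R).
  rewrite (bigD1_seq J) ?enum_uniq ?mem_enum //= eqxx mul1r big1 ?addr0 //.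
  by move=> J' /negPf->; rewrite mul0r.
rewrite /annihilation_exponent cardE; apply: ideal_expr_sum idP _ => J.
by rewrite mem_enum => /minor.
Qed.

(** * Cancellation along a regular sequence *)

Section RegularSequence.
Variable a : seq R.
Hypothesis a_regular : forall i : nat, (i < size a)%N ->
  forall x : R, gen a i (a`_i * x) -> gen a i x.

(** The case [r = 1], [s = k] of the division property, modulo the first [i] elements of [a]. *)
Definition divides_mod i q : Prop := forall g : L, ext_power q g ->
  ideal_ext (gen a i) (Omega * g) -> fil (gen a i) 1 q g.

(* If v = sum_J omega_J g_J vanishes modulo the first i + 1 elements of a,
   multiplying by the complementary omega's gives Omega g_J = 0, so each g_J is
   a combination of the omega's modulo these elements.  Subtracting multiples of
   the products omega_J from eta thus moves a_i eta one step down the filtration. *)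
Lemma fil_cancel i r p eta : (i < size a)%N ->
    (forall t, (r <= t <= p)%N -> divides_mod i.+1 (p - t)) -> ext_power p eta ->
  fil (gen a i) r p (sc a`_i * eta) -> fil (gen a i) r p eta.
Proof.
move=> ia dm; have idi := gen_ideal_is_ideal [set` take i a].
have idS := gen_ideal_is_ideal [set` take i.+1 a].
have aS : gen a i.+1 a`_i.
  by apply: gen_ideal_mem; rewrite /= (take_nth 0 ia) mem_rcons mem_head.
(* [t] is the current filtration step and [n] the number of steps left; at t = p + 1 only the ideal
   remains and a_i cancels by regularity. *)
suff H n t : (t + n = p.+1)%N -> (r <= t)%N -> forall eta, ext_power p eta ->
    fil (gen a i) t p (sc a`_i * eta) -> fil (gen a i) r p eta.
  move=> ep F; have [rp|pr] := leqP r p.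
    by apply: (H (p.+1 - r)%N r) F => //; rewrite subnKC // ltnW.
  exact/FilIdeal/(ideal_ext_regular e_basis idi (a_regular ia) ep)/(fil_gt pr F).
elim: n t => [|n IHn] t tn rt {}eta ep F.
  apply/FilIdeal/(ideal_ext_regular e_basis idi (a_regular ia) ep).
  by apply: (fil_gt _ F); lia.
have tp : (t <= p)%N by lia.
have [v [g [gp vE]] xv] := fil_representable tp F.
have vS : ideal_ext (gen a i.+1) v.
  rewrite -[v](subKr (sc a`_i * eta)); apply: ideal_extB; first exact: IdealExtM.
  exact: (ideal_ext_sub (gen_ideal_take_mono (i := i))) xv.
have gS J : J \in multiindices t k -> fil (gen a i.+1) 1 (p - t) (g J).
  move=> mJ; apply: dm => //; first by rewrite rt.
  have := ideal_extMl (W (cofactor_index J)) vS; rewrite vE cofactor_sum //.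
  rewrite -prod_enum.
  have [->//|->] := word_perm L omega (cofactor_index_perm mJ).
  by move=> /ideal_extN; rewrite mulNr opprK.
have /choice[d dE] : forall J, exists d, ext_power (p - t) d /\
    (J \in multiindices t k -> fil (gen a i) 1 (p - t) (g J - sc a`_i * d)).
  move=> J; have [mJ|_] := boolP (J \in _); last by exists 0; split=> //; apply: ext_power0.
  (* [w] approximates [g J] modulo the first i + 1 elements; it is homogeneous, so that the
     difference can be divided by a_i. In degree 0, [g J] itself lies in the ideal and [w = 0]
     works. *)
  have [w [wp wF gw]] : exists w, [/\ ext_power (p - t) w,
      fil (gen a i) 1 (p - t) w & ideal_ext (gen a i.+1) (g J - w)].
    have [pt|pt] := ltnP 0 (p - t).
      have [w wr gw] := fil_representable pt (gS J mJ); exists w; split=> //.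
        exact: representable_ext_power wr.
      exact: representable_fil wr.
    exists 0; split; [exact: ext_power0|exact/FilIdeal/IdealExt0|].
    by rewrite subr0; apply: (fil_gt _ (gS J mJ)); lia.
  have gwp : ext_power (p - t) (g J - w) by apply/ext_powerD/ext_powerN.
  have [d dp dI] := ideal_ext_split e_basis idS
    (fun y => @gen_ideal_takeS R a i y ia) gwp gw.
  exists d; split=> // _; rewrite -[g J](subrK w) addrAC.
  by apply: FilD => //; apply: FilIdeal.
have sumF (c : t.-tuple 'I_k -> L) u : (u <= t)%N ->
    (forall J, ext_power (p - t) (c J)) ->
    fil (gen a i) u p (\sum_(J in multiindices t k) wedge L omega J * c J).
  move=> ut cp; apply: fil_sum => J _; rewrite -(subnKC tp) -{1}(size_tuple J).
  by apply: fil_word => //; rewrite ?size_tuple // => j _; rewrite mem_enum.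
have sump : ext_power p (\sum_(J in multiindices t k) wedge L omega J * d J).
  apply: ext_power_sum => J _; rewrite -(subnKC tp) -{1}(size_tuple J).
  by apply: ext_power_prefix; case: (dE J).
rewrite -[eta](subrK (\sum_(J in multiindices t k) wedge L omega J * d J)).
apply: FilD; last by apply: sumF => // J; case: (dE J).
apply: (IHn t.+1) => //; [lia|lia|exact/ext_powerD/ext_powerN|].
(* What remains is the sum of the omega_J (g_J - a_i d_J), whose second factors contribute one more
   omega. *)
rewrite mulrBr -[_ * eta](subrK v) -addrA; apply: FilD; first exact: FilIdeal.
rewrite vE mulr_sumr -sumrB; apply: fil_sum => J mJ.
rewrite -ext_scalCA -mulrBr; have [_ /(_ mJ) dF] := dE J.
have := fil_wordM (w := enum 'I_k) (s := J) _ dF.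
by rewrite size_tuple addn1 subnKC //; apply=> j _; rewrite mem_enum.
Qed.

Hypothesis a_coef : forall x, x \in a -> IOmega x.

(** A power of a_i brings [eta] into the filtration; its factors are then cancelled one at a
    time. *)
Lemma annihilated_fil i r s p eta : (i < size a)%N ->
    (r + s = k + 1)%N ->
    (forall t, (r <= t <= p)%N -> divides_mod i.+1 (p - t)) -> ext_power p eta ->
    (forall t : seq 'I_k, size t = s -> ideal_ext (gen a i) (W t * eta)) ->
  fil (gen a i) r p eta.
Proof.
move=> ia rs dm ep B; have idi := gen_ideal_is_ideal [set` take i a].
have := coef_ideal_expr idi (a_coef (mem_nth 0 ia)) rs ep B.
elim: annihilation_exponent => [|n IHn] F.
  by move: F; rewrite expr0 rmorph1 mul1r.
apply: IHn; apply: fil_cancel => //; first exact: ext_powerZ.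
by rewrite mulrA -rmorphM -exprS.
Qed.

(** Induction on the degree: cancelling a_i uses one more element of the sequence but only degrees
    below [q], so the bound on [i + q] persists. *)
Lemma divides_mod_regular i q : (i + q < size a)%N -> divides_mod i q.
Proof.
elim/ltn_ind: q i => q IHq i iq g gq Og.
have O0 (t : seq 'I_k) : size t = k -> ideal_ext (gen a i) (W t * g).
  move=> tk; have [ut|/(word_repeat L omega)->] := boolP (uniq t); last first.
    by rewrite mul0r; apply: IdealExt0.
  have pt : perm_eq t (enum 'I_k).
    apply: uniq_perm => //; first exact: enum_uniq.
    have [|//|_ tE] := uniq_min_size ut (s2 := enum 'I_k).
    - by move=> j _; rewrite mem_enum.
    - by rewrite tk size_enum_ord.
    by move=> j; rewrite tE.
  move: Og; rewrite -prod_enum.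
  have [->//|->] := word_perm L omega pt.
  by move=> /ideal_extN; rewrite mulNr.
apply: annihilated_fil O0 => //; [lia|lia|].
by move=> t tq; apply: IHq; lia.
Qed.

End RegularSequence.

(** * Specialization to the zero ideal *)

(** A product of r + s = k + 1 of the omega's has a repeated factor, so [b] kills the product with
    [eta], and [b] cancels. *)
Lemma representable_condB r s p b (eta : L) : (r + s = k + 1)%N ->
    ext_power p eta -> GRing.lreg b -> representable omega p r (sc b * eta) ->
  condB omega s eta.
Proof.
move=> rs ep regb [g [_ gE]] J mJ; apply: ideal_ext0.
apply: (ideal_ext_regular e_basis (ideal0 R) (x := b) (q := (s + p)%N)).
- by move=> y by0; apply: regb; rewrite mulr0.
- by rewrite -{1}(size_tuple J); apply: ext_power_prefix.
rewrite -ext_scalCA gE mulr_sumr big1; first exact: IdealExt0.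
move=> J' _; rewrite mulrA; have := @word_repeat R M L _ omega (J ++ J').
rewrite big_cat => ->; first by rewrite mul0r.
apply: contraTN isT => uJ; have := card_uniqP uJ; have := max_card [in J ++ J'].
by rewrite card_ord size_cat !size_tuple => + E; rewrite E; lia.
Qed.

Lemma coef_ideal_representable r s p a (eta : L) : (r <= p)%N ->
    (r + s = k + 1)%N -> IOmega a -> ext_power p eta -> condB omega s eta ->
  representable omega p r (sc (a ^+ annihilation_exponent) * eta).
Proof.
move=> rp rs Ia ep B.
have /(fil_representable rp)[v rv] : fil [set 0] r p (sc (a ^+ annihilation_exponent) * eta).
  apply: (coef_ideal_expr (ideal0 R) Ia rs ep) => t st.
  by rewrite (condB_word B st); apply: IdealExt0.
by move=> /ideal_ext0/subr0_eq->.
Qed.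

Lemma depth_representable r s p (eta : L) : (r <= p)%N -> (r + s = k + 1)%N ->
    ((p%:Z - r%:Z)%:E <= depth IOmega - 2%:E)%E ->
    ext_power p eta -> condB omega s eta ->
  representable omega p r eta.
Proof.
(* For the unit ideal, 1 is an admissible multiplier. *)
move=> rp rs dp ep B; have [IT|IT] := pselect (IOmega = setT).
  have := @coef_ideal_representable r s p 1 eta rp rs; rewrite IT.
  by rewrite expr1n rmorph1 mul1r; apply.
rewrite subzn // in dp; have [a [[_ ra] aI sa]] := depth_regular_seq dp IT.
have zn : gen a 0 `<=` [set 0] by rewrite take0; apply: gen_ideal_nil.
have /(fil_representable rp)[v rv] : fil (gen a 0) r p eta.
  (* One element is cancelled here, and division modulo it in degrees up to p - r takes p - r + 1
     more: hence the 2 in the depth condition. *)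
  apply: (annihilated_fil ra aI _ rs _ ep); first by lia.
    by move=> t tp; apply: divides_mod_regular => //; lia.
  by move=> t st; rewrite (condB_word B st); apply: IdealExt0.
by move=> /(ideal_ext_sub zn)/ideal_ext0/subr0_eq->.
Qed.

End Main.

Theorem theorem2p1 (R : comPzRingType) (M : lmodType R) (m : nat)
    (e : 'I_m -> M) (e_basis : is_basis e) (L : exteriorAlgebra M)
    (k : nat) (hk : (1 <= k <= m)%N) (omega : 'I_k -> M)
    (p r s : nat) (hp : (1 <= p <= m)%N) (hr : (1 <= r <= m)%N)
    (hs : (1 <= s <= m)%N) (hpr : (r <= p)%N) (hrs : (r + s = k + 1)%N) :
  let Omega : L := \prod_(j < k) ext_inj L (omega j) in
  let IOmega : set R := coef_ideal e k Omega in
  let LpB : set L := [set eta | ext_power p eta /\ condB omega s eta] in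
  (((p%:Z - r%:Z)%:E <= depth IOmega - 2%:E)%E ->
     forall eta : L, ext_power p eta ->
       (representable omega p r eta <-> condB omega s eta)) /\
  (forall eta : L, ext_power p eta -> condB omega s eta ->
     exists n : nat, (0 < n)%N /\
       forall a : R, IOmega a ->
         representable omega p r (ext_scal L (a ^+ n) * eta)) /\
  (fin_gen LpB ->
     exists n : nat, (0 < n)%N /\
       forall eta : L, ext_power p eta -> condB omega s eta ->
       forall a : R, IOmega a ->
         representable omega p r (ext_scal L (a ^+ n) * eta)) /\
  (forall (eta : L) (b : R), ext_power p eta -> GRing.lreg b ->
     representable omega p r (ext_scal L b * eta) -> condB omega s eta).
Proof.
move=> Omega IOmega LpB; split=> [dp eta ep|].
  split=> [rep|]; last exact: depth_representable dp ep.
  (* Necessity of (B) in (i) is the converse in (ii) for b = 1. *)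
  apply: (representable_condB e_basis (b := 1) hrs ep); first exact: lreg1.
  by rewrite rmorph1 mul1r.
split=> [eta ep B|].
  exists (annihilation_exponent m k); split=> // a Ia.
  exact: (coef_ideal_representable e_basis hpr hrs Ia).
split=> [_|eta b ep regb]; last exact: representable_condB.
exists (annihilation_exponent m k); split=> // eta ep B a Ia.
exact: (coef_ideal_representable e_basis hpr hrs Ia).
Qed.
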